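(* Let $n\ge 2$. Let $T=(T_1,\dots,T_n)$ on $\mathcal H$ and $\widetilde T=(\widetilde T_1,\dots,\widetilde T_n)$ on $\widetilde{\mathcal H}$ be doubly twisted near-isometries with associated unitaries $\{U_{ij}\}_{1\le i\ne j\le n}$ on $\mathcal H$ and $\{\widetilde U_{ij}\}_{1\le i\neq j\le n}$ on $\widetilde{\mathcal H}$, respectively. Then $T\cong\widetilde T$ if and only if for each $A\subseteq I_n$ there exists a unitary $V_A:\mathcal D_A(T)\to\mathcal D_A(\widetilde T)$ such that on $\mathcal D_A(T)$ the following hold: (i) $V_A\big((T_A^{\boldsymbol k})^*T_A^{\boldsymbol k}\big)=\big((\widetilde T_A^{\boldsymbol k})^*\widetilde T_A^{\boldsymbol k}\big)V_A$ for all $\boldsymbol k\in\mathbb N_0^{|A|}$; (ii) $V_AT_j=\widetilde T_jV_A$ for $j\in I_n\setminus A$; (iii) $V_AU_{ij}=\widetilde U_{ij}V_A$ for $1\le i\ne j\le n$.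
   Context: All Hilbert spaces are complex and separable; $I_n=\{1,\dots,n\}$, $\mathbb N_0=\{0,1,2,\dots\}$. An operator $T\in B(\mathcal H)$ is a near-isometry if (i) there is $\delta>0$ with $\delta\|x\|\le\|Tx\|\le\|x\|$ for all $x\in\mathcal H$, and (ii) $T^{*n}T^{n+1}\mathcal H\subseteq T\mathcal H$ for each $n\ge 0$. Let $n\ge2$ and let $\{U_{ij}\}_{1\le i<j\le n}$ be commuting unitaries on $\mathcal H$. An $n$-tuple $(T_1,\dots,T_n)$ of near-isometries on $\mathcal H$ is a doubly twisted near-isometry with respect to $\{U_{ij}\}$ if for all $1\le i<j\le n$ and $1\le k\le n$: $T_i^*T_j=U_{ij}^*T_jT_i^*$, $T_kU_{ij}=U_{ij}T_k$, and $T_iT_j=U_{ij}T_jT_i$. One sets $U_{ji}:=U_{ij}^*$ for $i<j$. For $A=\{a_1<\dots<a_m\}\subseteq I_n$ and $\boldsymbol k\in\mathbb N_0^m$, $T_A^{\boldsymbol k}=T_{a_1}^{k_1}\cdots T_{a_m}^{k_m}$ (the identity if $A=\emptyset$). Put $\mathcal W_A=\bigcap_{i\in A}\ker T_i^*$ (with $\mathcal W_\emptyset=\mathcal H$) and $$\mathcal D_A(T)=\bigcap_{\boldsymbol\ell\in\mathbb N_0^{n-|A|}}T_{I_n\setminus A}^{\boldsymbol\ell}\mathcal W_A,$$ so $\mathcal D_\emptyset(T)=\bigcap_{\boldsymbol\ell\in\mathbb N_0^n}T_{I_n}^{\boldsymbol\ell}\mathcal H$. (The subspace $\mathcal D_A(T)$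 reduces $T_j$ for $j\notin A$, satisfies $U_{ij}\mathcal D_A(T)=\mathcal D_A(T)$, and $(T_A^{\boldsymbol k})^*T_A^{\boldsymbol k}\mathcal D_A(T)=\mathcal D_A(T)$, so the identities are meaningful.) $T\cong\widetilde T$ means there is a unitary $U:\mathcal H\to\widetilde{\mathcal H}$ with $UT_iU^*=\widetilde T_i$ for all $1\le i\le n$. *)

(* Defs.v *)
From HB Require Import structures.
From mathcomp Require Import all_boot all_order all_algebra.
From mathcomp Require Import complex.
From mathcomp Require Import all_classical all_reals all_analysis.

Set Implicit Arguments.
Unset Strict Implicit.
Unset Printing Implicit Defensive.
Import Order.TTheory GRing.Theory Num.Theory.
Import numFieldNormedType.Exports.

Local Open Scope classical_set_scope.
Local Open Scope ring_scope.
Local Open Scope complex_scope.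

(* Complex separable Hilbert spaces. The inner product is linear in its first
   argument; the space {0} is allowed. *)
HB.mixin Record CompleteNormedModule_isHilbert (R : realType) H
    of CompleteNormedModule R[i] H := {
  inner : {dot H for @Num.conj R[i]} ;
  inner_normE : forall x : H, inner x x = `|x| ^+ 2 ;
  separable_subproof : exists2 S : set H, countable S & dense S
}.

#[short(type="hilbertType")]
HB.structure Definition Hilbert (R : realType) :=
  {H of CompleteNormedModule R[i] H & CompleteNormedModule_isHilbert R H}.

(* The Hilbert space adjoint, as a total function: the unique [S] satisfying the
   defining identity when [T] is a bounded operator (Riesz), and a junk value
   when no such [S] exists. *)
Definition adj (R : realType) (H K : hilbertType R) (T : H -> K) : K -> H :=
  xget (fun=> 0) [set S : K -> H | forall x y, inner (T x) y = inner x (S y)].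

(* [V] restricts to a unitary from the subspace [D] of [H] onto the subspace [E]
   of [K], i.e. to a surjective linear isometry; its values outside [D] are
   irrelevant. *)
Definition unitary_between (R : realType) (H K : hilbertType R)
    (D : set H) (E : set K) (V : H -> K) : Prop :=
  [/\ forall (a : R[i]) x y, D x -> D y -> V (a *: x + y) = a *: V x + V y,
      forall x y, D x -> D y -> inner (V x) (V y) = inner x y
    & V @` D = E].

Definition unitary (R : realType) (H K : hilbertType R) (V : H -> K) : Prop :=
  unitary_between setT setT V.

(* The upper bound in the first clause makes [T] a bounded operator. *)
Definition near_isometry (R : realType) (H : hilbertType R)
    (T : {linear H -> H}) : Prop :=
  (exists2 delta : R, 0 < delta &
     forall x : H, delta%:C * `|x| <= `|T x| /\ `|T x| <= `|x|) /\
  (forall m : nat, range (iter m (adj T) \o iter m.+1 T) `<=` range T).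

(* Only the entries [U i j] with [i < j] are relevant. *)
Definition doubly_twisted (R : realType) (H : hilbertType R) (n : nat)
    (T : 'I_n -> {linear H -> H}) (U : 'I_n -> 'I_n -> {linear H -> H}) : Prop :=
  [/\ forall i, near_isometry (T i),
      forall i j : 'I_n, (i < j)%N -> unitary (U i j),
      forall i j k l : 'I_n, (i < j)%N -> (k < l)%N ->
        U i j \o U k l =1 U k l \o U i j
    & forall i j : 'I_n, (i < j)%N ->
        [/\ adj (T i) \o T j =1 adj (U i j) \o T j \o adj (T i),
            forall k : 'I_n, T k \o U i j =1 U i j \o T k
          & T i \o T j =1 U i j \o T j \o T i]].

(* The family [U] extended to all [i != j] by [U_ji := U_ij^*] for [i < j]
   (the diagonal is irrelevant). *)
Definition twist (R : realType) (H : hilbertType R) (n : nat)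
    (U : 'I_n -> 'I_n -> {linear H -> H}) (i j : 'I_n) : H -> H :=
  if (i < j)%N then (U i j : H -> H) else adj (U j i).

(* [T_{a_1}^{k_1} ... T_{a_m}^{k_m}] for [A = {a_1 < ... < a_m}]: [enum_val]
   lists the elements of [A] in increasing order. *)
Definition tuple_pow (R : realType) (H : hilbertType R) (n : nat)
    (T : 'I_n -> {linear H -> H}) (A : {set 'I_n}) (k : 'I_#|A| -> nat) : H -> H :=
  \big[(fun f g : H -> H => f \o g)/id]_(i < #|A|) iter (k i) (T (enum_val i)).

Definition wandering (R : realType) (H : hilbertType R) (n : nat)
    (T : 'I_n -> {linear H -> H}) (A : {set 'I_n}) : set H :=
  [set x | forall i, i \in A -> adj (T i) x = 0].

Definition Dspace (R : realType) (H : hilbertType R) (n : nat)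
    (T : 'I_n -> {linear H -> H}) (A : {set 'I_n}) : set H :=
  \bigcap_(l : 'I_#|(~: A)%SET| -> nat) (tuple_pow T l @` wandering T A).

Definition unitarily_equivalent (R : realType) (H K : hilbertType R) (n : nat)
    (T : 'I_n -> {linear H -> H}) (T' : 'I_n -> {linear K -> K}) : Prop :=
  exists2 V : H -> K, unitary V & forall i, V \o T i \o adj V =1 T' i.

(* Main.v *)
Require Import Defs.
From HB Require Import structures.
From mathcomp Require Import all_boot all_order all_algebra.
From mathcomp Require Import complex.
From mathcomp Require Import all_classical all_reals all_analysis.
From mathcomp Require Import ring lra.
Set Implicit Arguments.
Unset Strict Implicit.
Unset Printing Implicit Defensive.
Import Order.TTheory GRing.Theory Num.Theory.
Import numFieldNormedType.Exports.
Local Open Scope classical_set_scope.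
Local Open Scope ring_scope.
Local Open Scope complex_scope.

(* Near-isometries have a Wold decomposition: T_i^m ker T_i^* (m in N) and the
   intersection of the ranges of T_i^m are pairwise orthogonal and together
   total.  Since T_i^* T_j = U_ij^* T_j T_i^*, each of these spaces reduces T_j
   for j <> i, so successive projections decompose H into the joint pieces
   T_A^k D_A(T).  The maps T_A^k x |-> T'_A^k (V_A x) are isometric by (i), hence
   the total families of vectors T_A^k x and T'_A^k (V_A x) have the same Gram
   matrix and define a unitary of H onto K.  Pushing T_j through T_A^k produces
   only twists and possibly a factor T_j, so (ii) and (iii) make it intertwine
   T_j and T'_j.  Conversely, T_j T_i U_ij = T_i T_j with T_j T_i injective, so
   a unitary intertwining the T_i also intertwines the U_ij. *)

(** * Hilbert spaces *)

Lemma innerC (R : realType) (H : hilbertType R) (x y : H) :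
  inner y x = (inner x y)^*%C.
Proof. by rewrite (@hermC _ _ _ _ (inner : {dot H for _})) expr0 mul1r. Qed.

Lemma innerDl (R : realType) (H : hilbertType R) (x y z : H) :
  inner (x + y) z = inner x z + inner y z.
Proof. exact: linearDl. Qed.

Lemma innerDr (R : realType) (H : hilbertType R) (x y z : H) :
  inner z (x + y) = inner z x + inner z y.
Proof. exact: linearDr. Qed.

Lemma innerZl (R : realType) (H : hilbertType R) (a : R[i]) (x y : H) :
  inner (a *: x) y = a * inner x y.
Proof. exact: linearZl_LR. Qed.

Lemma innerZr (R : realType) (H : hilbertType R) (a : R[i]) (x y : H) :
  inner x (a *: y) = a^*%C * inner x y.
Proof. exact: linearZr_LR. Qed.

Lemma innerBl (R : realType) (H : hilbertType R) (x y z : H) :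
  inner (x - y) z = inner x z - inner y z.
Proof. exact: linearBl. Qed.

Lemma innerBr (R : realType) (H : hilbertType R) (x y z : H) :
  inner z (x - y) = inner z x - inner z y.
Proof. exact: linearBr. Qed.

Lemma inner0l (R : realType) (H : hilbertType R) (x : H) : inner 0 x = 0.
Proof. exact: linear0l. Qed.

Lemma inner0r (R : realType) (H : hilbertType R) (x : H) : inner x 0 = 0.
Proof. exact: linear0r. Qed.

(** The norm of [H] takes values in [R[i]]. Its square is recorded as an element of the ordered
    field [R], where all estimates below take place. *)
Definition sqn (R : realType) (H : hilbertType R) (x : H) : R :=
  complex.Re (inner x x).

Lemma inner_ge0 (R : realType) (H : hilbertType R) (x : H) : 0 <= inner x x.
Proof. by rewrite inner_normE exprn_ge0. Qed.

Lemma sqnE (R : realType) (H : hilbertType R) (x : H) :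
  inner x x = (sqn x)%:C.
Proof. by rewrite /sqn RRe_real // ger0_real // inner_ge0. Qed.

Lemma sqn_ge0 (R : realType) (H : hilbertType R) (x : H) : 0 <= sqn x.
Proof. by rewrite -ler0c -sqnE inner_ge0. Qed.

Lemma sqn_normE (R : realType) (H : hilbertType R) (x : H) :
  `|x| ^+ 2 = (sqn x)%:C.
Proof. by rewrite -sqnE inner_normE. Qed.

Lemma sqn_eq0 (R : realType) (H : hilbertType R) (x : H) : sqn x = 0 -> x = 0.
Proof.
by move=> h; apply/eqP; rewrite -normr_eq0 -sqrf_eq0 sqn_normE h.
Qed.

Lemma sqnD (R : realType) (H : hilbertType R) (x y : H) :
  sqn (x + y) = sqn x + sqn y + 2 * complex.Re (inner x y).
Proof.
rewrite /sqn innerDl !innerDr (innerC x y).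
case: (inner x x) (inner x y) (inner y y) => [? ?] [? ?] [? ?] /=; ring.
Qed.

Lemma sqnB (R : realType) (H : hilbertType R) (x y : H) :
  sqn (x - y) = sqn x + sqn y - 2 * complex.Re (inner x y).
Proof.
rewrite /sqn innerBl !innerBr (innerC x y).
case: (inner x x) (inner x y) (inner y y) => [? ?] [? ?] [? ?] /=; ring.
Qed.

Lemma sqnZ (R : realType) (H : hilbertType R) (a : R[i]) (x : H) :
  sqn (a *: x) = (complex.Re a ^+ 2 + complex.Im a ^+ 2) * sqn x.
Proof.
rewrite {1}/sqn innerZl innerZr sqnE.
by case: a => [? ?] /=; ring.
Qed.

Lemma sqn0 (R : realType) (H : hilbertType R) : sqn (0 : H) = 0.
Proof. by rewrite /sqn inner0l. Qed.

Lemma sqn_subC (R : realType) (H : hilbertType R) (x y : H) :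
  sqn (x - y) = sqn (y - x).
Proof. by rewrite !sqnB (innerC x y); case: (inner x y) => ? ? /=; ring. Qed.

(** Parallelogram law with the term [sqn (a - b)] dropped, which is where the factors 2 come
    from. *)
Lemma sqn_triangle (R : realType) (H : hilbertType R) (x y z : H) :
  sqn (x - z) <= 2 * sqn (x - y) + 2 * sqn (y - z).
Proof.
have -> : x - z = (x - y) + (y - z) by rewrite addrA subrK.
by move: (x - y) (y - z) => a b; have := sqn_ge0 (a - b); rewrite sqnB sqnD;
  lra.
Qed.

(** Expanding the square of [(sqn y)%:C *: x - inner x y *: y] gives [sqn y] times the difference of
    the two sides. *)
Lemma CauchySchwarz_sqn (R : realType) (H : hilbertType R) (x y : H) :
  complex.Re (inner x y) ^+ 2 + complex.Im (inner x y) ^+ 2 <= sqn x * sqn y.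
Proof.
pose a := inner x y.
have [y0|yn0] := eqVneq (sqn y) 0.
  by rewrite (sqn_eq0 y0) inner0r sqn0 /= expr0n mulr0 addr0.
have y_gt0 : 0 < sqn y by rewrite lt_def yn0 sqn_ge0.
have := sqn_ge0 ((sqn y)%:C *: x - a *: y).
rewrite sqnB !sqnZ innerZl innerZr -/a.
case: a => [p q] /=; have := y_gt0; move: (sqn x) (sqn y) => u v v0 h.
have: 0 <= v * (u * v - (p ^+ 2 + q ^+ 2)) by move: h; congr (_ <= _); ring.
by rewrite pmulr_rge0 // subr_ge0.
Qed.

Lemma norm_lt_sqn (R : realType) (H : hilbertType R) (x : H) (e : R) :
  0 < e -> (`|x| < e%:C) = (sqn x < e ^+ 2).
Proof.
move=> e0; rewrite -ltcR -sqn_normE rmorphXn /= ltr_pXn2r //.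
  by rewrite nnegrE.
by rewrite nnegrE ler0c ltW.
Qed.

Lemma hilbert_complete (R : realType) (H : hilbertType R) (u : nat -> H) :
  (forall e : R, 0 < e -> exists N, forall p q, (N <= p)%N -> (N <= q)%N ->
     sqn (u p - u q) < e) ->
  exists l, forall e : R, 0 < e -> exists N, forall m, (N <= m)%N ->
     sqn (l - u m) < e.
Proof.
move=> hu.
have /cauchy_cvgP cu : cauchy (u @ \oo).
  apply: cauchy_exP => eps eps0.
  have epsE : eps = (complex.Re eps)%:C by rewrite RRe_real // ger0_real // ltW.
  have e0 : 0 < complex.Re eps by rewrite -ltcR -epsE.
  have [N hN] := hu _ (exprn_gt0 2 e0); exists (u N).
  exists N => // p /= Np; rewrite -ball_normE /= epsE norm_lt_sqn //.
  exact: hN.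
have /cvgrPdist_lt cl := cu.
exists (lim (u @ \oo)) => e e0.
have s0 : 0 < Num.sqrt e by rewrite sqrtr_gt0.
have [|N _ hN] := cl (Num.sqrt e)%:C; first by rewrite ltcR.
exists N => m Nm; have := hN m Nm => /=.
by rewrite norm_lt_sqn // sqr_sqrtr // ltW.
Qed.

(** * Closed subspaces and orthogonal projections *)

Definition closed_subspace (R : realType) (H : hilbertType R) (F : set H) :=
  [/\ F 0, forall a x y, F x -> F y -> F (a *: x + y)
    & forall x, (forall e : R, 0 < e -> exists2 y, F y & sqn (x - y) < e) ->
      F x].

Definition orth (R : realType) (H : hilbertType R) (F : set H) : set H :=
  [set x | forall y, F y -> inner x y = 0].

Lemma inner_eq0 (R : realType) (H : hilbertType R) (x y : H) :
  (complex.Re (inner x y)) ^+ 2 + (complex.Im (inner x y)) ^+ 2 = 0 ->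
  inner x y = 0.
Proof.
case: (inner x y) => p q /= h; apply/eqP; rewrite eq_complex /=.
by move/eqP: h; rewrite paddr_eq0 ?sqr_ge0 // !sqrf_eq0.
Qed.

Lemma subspaceD (R : realType) (H : hilbertType R) (F : set H) x y :
  closed_subspace F -> F x -> F y -> F (x + y).
Proof. by case=> _ h _ Fx Fy; rewrite -[x]scale1r; apply: h. Qed.

Lemma subspaceZ (R : realType) (H : hilbertType R) (F : set H) a x :
  closed_subspace F -> F x -> F (a *: x).
Proof. by case=> h0 h _ Fx; rewrite -[_ *: _]addr0; apply: h. Qed.

Lemma subspaceB (R : realType) (H : hilbertType R) (F : set H) x y :
  closed_subspace F -> F x -> F y -> F (x - y).
Proof.
by move=> cF Fx Fy; rewrite -scaleN1r; apply: subspaceD => //; apply: subspaceZ.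
Qed.

(** Moving [y] along [f] by the coefficient [inner (x - y) f / sqn f] lowers the squared distance to
    [x] by the left side divided by [sqn f], and it cannot drop below [d]. *)
Lemma orth_near_minimal (R : realType) (H : hilbertType R) (F : set H)
    (x y f : H) (d e : R) :
  closed_subspace F -> (forall z, F z -> d <= sqn (x - z)) -> F y ->
  sqn (x - y) < d + e -> F f ->
  complex.Re (inner (x - y) f) ^+ 2 + complex.Im (inner (x - y) f) ^+ 2
    <= e * sqn f.
Proof.
move=> cF hd Fy xy Ff.
have [f0|fn0] := eqVneq (sqn f) 0.
  by rewrite (sqn_eq0 f0) inner0r sqn0 /= expr0n mulr0 addr0.
have f_gt0 : 0 < sqn f by rewrite lt_def fn0 sqn_ge0.
pose c := inner (x - y) f.
have := hd (y + ((sqn f)^-1%:C * c) *: f) (subspaceD cF Fy (subspaceZ _ cF Ff)).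
rewrite opprD addrA sqnB innerZr sqnZ -/c.
case: c => p q /=; rewrite !mul0r subr0 addr0; move: (sqn f) f_gt0 => s s0 h.
have hs : s^-1 * s = 1 by rewrite mulVf // gt_eqF.
have h1 : s^-1 * (p ^+ 2 + q ^+ 2) < e.
  have : sqn (x - y) + ((s^-1 * p) ^+ 2 + (s^-1 * q) ^+ 2) * s -
     2 * (s^-1 * p * p - - (s^-1 * q) * q)
     = sqn (x - y) + (s^-1 * s - 2) * (s^-1 * (p ^+ 2 + q ^+ 2)) by ring.
  by rewrite hs => h2; lra.
by rewrite ltW // -ltr_pdivrMr // mulrC.
Qed.

Lemma invSn_lt (R : realType) (e : R) : 0 < e ->
  exists N, forall m, (N <= m)%N -> m.+1%:R^-1 < e.
Proof.
move=> e0; have [N _ h] := near_infty_natSinv_lt (PosNum e0).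
by exists N => m Nm; exact: h.
Qed.

(** A minimizing sequence is Cauchy by the parallelogram law. Its limit is shown orthogonal by
    passing to the limit in [orth_near_minimal]. *)
Lemma projection (R : realType) (H : hilbertType R) (F : set H) (x : H) :
  closed_subspace F -> exists2 y, F y & orth F (x - y).
Proof.
move=> cF; have [F0 _ Fcl] := cF.
pose S := [set sqn (x - y) | y in F].
have hS : has_inf S.
  split; first by exists (sqn (x - 0)), 0.
  by exists 0 => _ [y _ <-]; exact: sqn_ge0.
have hd z : F z -> inf S <= sqn (x - z).
  by move=> Fz; apply: ge_inf; [exact: hS.2|exists z].
have hy m : exists y, F y /\ sqn (x - y) < inf S + m.+1%:R^-1.
  have [|_ [y Fy <-] h] := @inf_adherent _ S m.+1%:R^-1 _ hS.
    by rewrite invr_gt0.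
  by exists y.
have [y yP] := choice hy.
have [|l hl] := @hilbert_complete _ H y.
  move=> e e0; have [|N hN] := @invSn_lt _ (e / 4); first by lra.
  exists N => p q /hN Np /hN Nq.
  have hp := (yP p).2; have hq := (yP q).2.
  (* The midpoint lies in [F], so its squared distance to [x] is at least [inf S]; hence
     [sqn (y p - y q)] is at most 2 times the sum of the two excesses over [inf S], each below
     [e / 4]. *)
  have := hd (2^-1 *: (y p + y q)).
  move=> /(_ (subspaceZ _ cF (subspaceD cF (yP p).1 (yP q).1))).
  have -> : y p - y q = (x - y q) - (x - y p).
    by rewrite opprB [RHS]addrC addrA subrK.
  have -> : x - 2^-1 *: (y p + y q) = 2^-1 *: ((x - y q) + (x - y p)).
    rewrite addrACA -opprD scalerBr [y q + _]addrC; congr (_ - _).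
    by rewrite scalerDr -scalerDl -div1r -splitr scale1r.
  move: (x - y p) (x - y q) hp hq => a b hp hq.
  rewrite sqnZ sqnB sqnD.
  have -> : (2^-1 : R[i]) = (2^-1 : R)%:C.
    by rewrite rmorphV ?unitfE ?pnatr_eq0 // rmorph_nat.
  rewrite /= => h.
  move: Np Nq hp hq; move: (p.+1%:R^-1) (q.+1%:R^-1) => p' q' Np Nq hp hq.
  have E : 2^-1 ^+ 2 + 0 ^+ 2 = 4^-1 :> R by rewrite expr0n addr0 exprVn -natrX.
  rewrite E in h; lra.
have Fl : F l.
  apply: Fcl => e /hl [N hN]; exists (y N); [exact: (yP N).1|exact: hN].
exists l => // f Ff; apply: inner_eq0.
apply/eqP; rewrite eq_le addr_ge0 ?sqr_ge0 // andbT.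
apply/ler_addgt0Pl => e e0; rewrite addr0.
have s0 := sqn_ge0 f.
(* With this [t] both error terms, from near-minimality and from [l - y m], are at most [e / 4]; the
   [+ 1] keeps the divisor positive when [f] is 0. *)
have [t tE t0] : exists2 t, t * (4 * (sqn f + 1)) = e & 0 < t.
  have k0 : 0 < 4 * (sqn f + 1) by lra.
  by exists (e / (4 * (sqn f + 1))); rewrite ?divr_gt0 // divfK // gt_eqF.
have [N1 hN1] := invSn_lt t0.
have [N2 hN2] := hl _ t0.
pose m := maxn N1 N2.
have m1 := hN1 m (leq_maxl _ _).
have m2 := hN2 m (leq_maxr _ _).
have h1 : sqn (x - y m) < inf S + t by rewrite (lt_trans (yP m).2) // ltrD2l.
have {h1} := orth_near_minimal cF hd (yP m).1 h1 Ff.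
have := CauchySchwarz_sqn (l - y m) f.
have -> : x - l = (x - y m) - (l - y m) by rewrite opprB addrA subrK.
rewrite [inner (_ - (l - y m)) f]innerBl.
case: (inner (x - y m) f) (inner (l - y m) f) => [a b] [c d] /= h1 h2.
have h3 : sqn (l - y m) * sqn f <= t * sqn f by rewrite ler_wpM2r // ltW.
have h4 : t * sqn f <= e / 4 by lra.
by have := sqr_ge0 (a + c); have := sqr_ge0 (b + d); lra.
Qed.

(** Cauchy-Schwarz bounds the value by arbitrarily small numbers. This is how orthogonality
    relations are passed to limits. *)
Lemma inner_small (R : realType) (H : hilbertType R) (x y : H) :
  (forall e : R, 0 < e -> exists2 w : H, sqn w < e & inner x y = inner w y) ->
  inner x y = 0.
Proof.
move=> h; apply: inner_eq0; apply/eqP.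
rewrite eq_le addr_ge0 ?sqr_ge0 // andbT.
apply/ler_addgt0Pl => e e0; rewrite addr0.
have s0 := sqn_ge0 y.
have k0 : 0 < sqn y + 1 by lra.
have [w hw ->] := h (e / (sqn y + 1)) (divr_gt0 e0 k0).
apply: le_trans (CauchySchwarz_sqn _ _) _.
have /ltW := hw; rewrite ler_pdivlMr // => h1.
by have := sqn_ge0 w; lra.
Qed.

Lemma orth_closed (R : realType) (H : hilbertType R) (F : set H) :
  closed_subspace (orth F).
Proof.
split=> [y _|a x y ox oy z Fz|x hx y Fy].
- by rewrite inner0l.
- by rewrite innerDl innerZl ox // oy // mulr0 addr0.
- apply: inner_small => e /hx[x' ox' xx']; exists (x - x') => //.
  by rewrite innerBl ox' // subr0.
Qed.

Lemma inner_eq0C (R : realType) (H : hilbertType R) (x y : H) :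
  inner x y = 0 -> inner y x = 0.
Proof. by rewrite (innerC x y) => ->; rewrite conjc0. Qed.

Lemma inner_self0 (R : realType) (H : hilbertType R) (x : H) :
  inner x x = 0 -> x = 0.
Proof. by move=> h; apply: sqn_eq0; rewrite /sqn h. Qed.

Lemma orth_orth (R : realType) (H : hilbertType R) (F : set H) (x : H) :
  closed_subspace F -> (forall y, orth F y -> inner x y = 0) -> F x.
Proof.
move=> cF hx; have [p Fp op] := projection x cF.
suff /eqP : x - p = 0 by rewrite subr_eq0 => /eqP ->.
by apply: inner_self0; rewrite {1}innerBl hx // (inner_eq0C (op _ Fp)) subr0.
Qed.

(** * Adjoint pairs and existence of adjoints *)

Definition adjoint_pair (R : realType) (H K : hilbertType R) (S : H -> K)
    (S' : K -> H) := forall x y, inner (S x) y = inner x (S' y).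

Lemma inner_ext (R : realType) (H : hilbertType R) (y z : H) :
  (forall x, inner x y = inner x z) -> y = z.
Proof.
move=> h; apply/eqP; rewrite -subr_eq0; apply/eqP/inner_self0.
by rewrite innerBr h subrr.
Qed.

(** Adjoints are unique because inner products separate points, so the choice made by [xget] agrees
    with any adjoint at hand. *)
Lemma adj_eq (R : realType) (H K : hilbertType R) (S : H -> K) (S' : K -> H) :
  adjoint_pair S S' -> adj S = S'.
Proof.
move=> hS; rewrite /adj; case: xgetP => [S1 _ /= h1|/(_ S') //].
by apply/funext => y; apply: inner_ext => x; rewrite -h1 hS.
Qed.

Lemma adjoint_pair_sym (R : realType) (H K : hilbertType R) (S : H -> K)
  (S' : K -> H) : adjoint_pair S S' -> adjoint_pair S' S.
Proof. by move=> h x y; rewrite (innerC y) (innerC (S y)) h. Qed.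

Lemma adjoint_pair_comp (R : realType) (H K L : hilbertType R) (S : K -> L)
  (S' : L -> K) (Q : H -> K) (Q' : K -> H) :
  adjoint_pair S S' -> adjoint_pair Q Q' -> adjoint_pair (S \o Q) (Q' \o S').
Proof. by move=> hS hQ x y; rewrite /= hS hQ. Qed.

Lemma adjoint_pair_iter (R : realType) (H : hilbertType R) (S S' : H -> H) k :
  adjoint_pair S S' -> adjoint_pair (iter k S) (iter k S').
Proof.
by move=> h; elim: k => // k IH x y; rewrite iterS h IH -iterSr.
Qed.

(** Riesz representation: the functional sending [x] to [inner (T x) y] is represented by a multiple
    of a vector orthogonal to its closed kernel [F]. *)
Lemma adjointP (R : realType) (H : hilbertType R) (T : {linear H -> H}) :
  (forall x, sqn (T x) <= sqn x) -> adjoint_pair T (adj T).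
Proof.
move=> bT; suff [S hS] : exists S, adjoint_pair T S by rewrite (adj_eq hS).
suff /choice [S hS] : forall y, exists z, forall x, inner (T x) y = inner x z.
  by exists S => x y; exact: hS.
move=> y; pose F := [set x | inner (T x) y = 0].
have cF : closed_subspace F.
  split=> [|a x z Fx Fz|x hx]; rewrite /F /=.
  - by rewrite linear0 inner0l.
  - by rewrite linearP innerDl innerZl Fx Fz mulr0 addr0.
  - apply: inner_small => e /hx[x' Fx' xx'].
    exists (T (x - x')); first exact: le_lt_trans xx'.
    by rewrite linearB innerBl Fx' subr0.
have [h|/existsNP[x0 hx0]] := pselect (forall x, F x).
  by exists 0 => x; rewrite inner0r h.
have [p Fp op] := projection x0 cF.
set z := x0 - p in op; set c := inner (T z) y.
have c0 : c != 0 by apply/eqP; rewrite /c linearB innerBl Fp subr0.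
have z0 : inner z z != 0.
  by apply: contra c0 => /eqP/inner_self0; rewrite /c => ->;
    rewrite linear0 inner0l.
(* The scalar is conjugated because [inner] is conjugate-linear in its second argument; it is found
   by testing at [x = z]. *)
exists (((c / inner z z)^*)%C *: z) => x.
rewrite innerZr conjcK.
have /op/inner_eq0C : F (x - (inner (T x) y / c) *: z).
  by rewrite /F /= linearB linearZ_LR innerBl innerZl -/c divfK // subrr.
move/eqP; rewrite innerBl innerZl subr_eq0 => /eqP ->.
by field; apply/andP.
Qed.

(** * Unitaries from equal Gram matrices *)

Definition closed_rel (R : realType) (H K : hilbertType R)
    (P : H -> K -> Prop) :=
  [/\ P 0 0,
      forall a x y x' y', P x x' -> P y y' -> P (a *: x + y) (a *: x' + y')
    & forall x x', (forall e : R, 0 < e -> exists y y',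
        [/\ P y y', sqn (x - y) < e & sqn (x' - y') < e]) -> P x x'].

(* The smallest closed linear relation containing [G]; for [G] preserving inner
   products it is the graph of a partial isometry. *)
Definition hull (R : realType) (H K : hilbertType R)
    (G : H -> K -> Prop) x x' :=
  forall P, closed_rel P -> (forall z z', G z z' -> P z z') -> P x x'.

Section Hull.
Variables (R : realType) (H K : hilbertType R) (G : H -> K -> Prop).

Lemma hull_closed : closed_rel (hull G).
Proof.
split=> [P [] //|a x y x' y' hx hy P cP GP|x x' hx P cP GP].
  by have [_ h _] := cP; apply: h; [exact: hx|exact: hy].
have [_ _ h] := cP; apply: h => e /hx[y [y' [hy xy xy']]].
by exists y, y'; split=> //; exact: hy.
Qed.

Lemma hull_gen z z' : G z z' -> hull G z z'.
Proof. by move=> h P _; apply. Qed.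

Hypothesis G_inner :
  forall z z' w w', G z z' -> G w w' -> inner z w = inner z' w'.

(** Makes the closed linear relations usable for induction on the hull, one argument of the inner
    product at a time. *)
Lemma closed_rel_inner (y : H) (y' : K) :
  closed_rel (fun x x' => inner x y = inner x' y').
Proof.
split=> [|a x z x' z' hx hz|x x' hx].
- by rewrite !inner0l.
- by rewrite !innerDl !innerZl hx hz.
- have h (e : R) : 0 < e -> exists2 d, d < e &
     complex.Re (inner x y - inner x' y') ^+ 2 +
     complex.Im (inner x y - inner x' y') ^+ 2 <= d.
    move=> e0; have s0 := sqn_ge0 y; have s0' := sqn_ge0 y'.
    (* The error is a difference of two inner products; its squared modulus is at most twice the sum
       of the two Cauchy-Schwarz bounds, so dividing [e] by this number suffices. *)
    have k0 : 0 < 2 * (sqn y + sqn y' + 1) by lra.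
    have [w [w' [hw xw xw']]] := hx _ (divr_gt0 e0 k0).
    have := CauchySchwarz_sqn (x - w) y; have := CauchySchwarz_sqn (x' - w') y'.
    have -> : inner x y - inner x' y' = inner (x - w) y - inner (x' - w') y'.
      by rewrite !innerBl hw; ring.
    case: (inner (x - w) y) (inner (x' - w') y') => [a b] [c d] /= h1 h2.
    eexists; last exact: lexx.
    move: xw xw'; rewrite !ltr_pdivlMr // => xw xw'.
    have := sqr_ge0 (a + c); have := sqr_ge0 (b + d).
    have := sqn_ge0 (x - w); have := sqn_ge0 (x' - w'); nra.
  apply/eqP; rewrite -subr_eq0 eq_complex /=.
  set u := _ - _ in h *.
  have : complex.Re u ^+ 2 + complex.Im u ^+ 2 == 0.
    rewrite eq_le addr_ge0 ?sqr_ge0 // andbT.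
    apply/ler_addgt0Pl => e /h[d de hd]; rewrite addr0.
    by rewrite (le_trans hd) // ltW.
  by rewrite paddr_eq0 ?sqr_ge0 // !sqrf_eq0.
Qed.

Lemma hull_inner x x' y y' : hull G x x' -> hull G y y' ->
  inner x y = inner x' y'.
Proof.
move=> hx hy; apply: (hx _ (closed_rel_inner y y')) => z z' Gz.
rewrite innerC [RHS]innerC; congr conjc.
apply: (hy _ (closed_rel_inner z z')) => w w' Gw; exact: G_inner.
Qed.

End Hull.

(** The domain is closed: a convergent sequence in it has Cauchy partners because [P] is isometric,
    and [P] is closed. By [projection] and totality it is then everything. *)
Lemma isometric_rel_dom (R : realType) (H K : hilbertType R)
    (P : H -> K -> Prop) :
  closed_rel P ->
  (forall x x' y y', P x x' -> P y y' -> inner x y = inner x' y') ->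
  (forall x, (forall z z', P z z' -> inner x z = 0) -> x = 0) ->
  forall x, exists x', P x x'.
Proof.
move=> [P0 PL Pcl] Pin Ptot.
pose D := [set x | exists x', P x x'].
have PB x x' y y' : P x x' -> P y y' -> P (x - y) (x' - y').
  move=> hx hy; have := PL (-1) _ _ _ _ hy hx.
  by rewrite !scaleN1r addrC [- y' + _]addrC.
have cD : closed_subspace D.
  split=> [|a x y [x' hx] [y' hy]|x hx]; first by exists 0.
    by exists (a *: x' + y'); exact: PL.
  have /choice[y hy] : forall m, exists y, D y /\ sqn (x - y) < m.+1%:R^-1.
    by move=> m; have [|y Dy xy] := hx m.+1%:R^-1; [rewrite invr_gt0|exists y].
  have /choice[y' hy'] : forall m, exists y', P (y m) y'.
    by move=> m; case: (hy m).
  have [|l hl] := @hilbert_complete _ K y'.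
    move=> e e0; have [|N hN] := @invSn_lt _ (e / 4); first by lra.
    exists N => p q /hN hp /hN hq.
    have Ppq := PB _ _ _ _ (hy' p) (hy' q).
    rewrite /sqn -(Pin _ _ _ _ Ppq Ppq).
    apply: le_lt_trans (sqn_triangle (y p) x (y q)) _.
    have := lt_trans (hy p).2 hp; have := lt_trans (hy q).2 hq.
    by rewrite (sqn_subC (y p)); lra.
  exists l; apply: Pcl => e e0.
  have [N hN] := invSn_lt e0; have [M hM] := hl _ e0.
  exists (y (maxn N M)), (y' (maxn N M)); split=> //.
    exact: lt_trans (hy _).2 (hN _ (leq_maxl _ _)).
  exact: hM _ (leq_maxr _ _).
move=> x; have [p Dp op] := projection x cD.
suff -> : x = p by [].
apply/eqP; rewrite -subr_eq0; apply/eqP/Ptot => z z' hz.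
by apply: op; exists z'.
Qed.

(** The graph of [V] is the hull of [G]: it is everywhere defined in both directions by totality,
    and single-valued because it preserves inner products. *)
Lemma gram_unitary (R : realType) (H K : hilbertType R) (G : H -> K -> Prop) :
  (forall z z' w w', G z z' -> G w w' -> inner z w = inner z' w') ->
  (forall x, (forall z z', G z z' -> inner x z = 0) -> x = 0) ->
  (forall x, (forall z z', G z z' -> inner x z' = 0) -> x = 0) ->
  exists2 V : H -> K, unitary V &
    forall (S : {linear H -> H}) (S' : {linear K -> K}),
      (forall x, sqn (S x) <= sqn x) -> (forall x, sqn (S' x) <= sqn x) ->
      (forall z z', G z z' -> G (S z) (S' z')) ->
      forall x, V (S x) = S' (V x).
Proof.
move=> Gin GtotH GtotK.
have cG := hull_closed G; have hin := hull_inner Gin.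
have [G0 GL Gcl] := cG.
have domH : forall x, exists x', hull G x x'.
  apply: (isometric_rel_dom cG hin) => x hx.
  by apply: GtotH => z z' /hull_gen; exact: hx.
have domK : forall x', exists x, hull G x x'.
  apply: (@isometric_rel_dom _ K H (fun x' x => hull G x x')).
  - split=> // [a x y x' y'|x x' hx]; first exact: GL.
    by apply: Gcl => e /hx[y [y' [hy xy xy']]]; exists y', y.
  - by move=> x x' y y' hx hy; rewrite -(hin _ _ _ _ hx hy).
  - move=> x hx; apply: GtotK => z z' /hull_gen; exact: hx.
have [V VP] := choice domH.
have Vuniq x y : hull G x y -> V x = y.
  move=> hy; apply/eqP; rewrite -subr_eq0; apply/eqP/inner_self0.
  (* Two values at [x] differ by a partner of 0, which has norm 0 by isometry. *)
  have h : hull G (x - x) (V x - y).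
    by have := GL (-1) _ _ _ _ hy (VP x);
      rewrite !scaleN1r [- y + _]addrC addNr subrr.
  by rewrite -(hin _ _ _ _ h h) subrr inner0l.
exists V.
  split=> [a x y _ _|x y _ _|].
  - by apply: Vuniq; exact: GL.
  - by rewrite -(hin _ _ _ _ (VP x) (VP y)).
  - apply/seteqP; split=> // x' _; have [x hx] := domK x'.
    by exists x => //; exact: Vuniq.
move=> S S' bS bS' hS x; apply: Vuniq.
(* Minimality of the hull: the pullback of [hull G] along [S] and [S'] is closed and linear and
   contains [G]. *)
apply: (VP x (fun x x' => hull G (S x) (S' x'))) => [|z z' Gz]; last first.
  by apply: hull_gen; exact: hS.
split=> [|a y z y' z' hy hz|y y' hy].
- by rewrite !linear0.
- by rewrite !linearP; exact: GL.
- apply: Gcl => e /hy[w [w' [hw yw yw']]]; exists (S w), (S' w').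
  split=> //; rewrite -linearB; first exact: le_lt_trans (bS _) yw.
  exact: le_lt_trans (bS' _) yw'.
Qed.

Lemma unitary_adjP (R : realType) (H K : hilbertType R) (V : H -> K) :
  unitary V ->
  [/\ adjoint_pair V (adj V), cancel V (adj V) & cancel (adj V) V].
Proof.
case=> Vlin Viso Vsurj.
have /choice[W WK] : forall y, exists x, V x = y.
  move=> y; have [x _ <-] : (V @` setT) y by rewrite Vsurj.
  by exists x.
have VW : adjoint_pair V W by move=> x y; rewrite -{1}(WK y) Viso.
rewrite (adj_eq VW); split=> // x; apply: inner_ext => z.
by rewrite -VW Viso.
Qed.

Lemma adjoint_pair0 (R : realType) (H K : hilbertType R) (S : H -> K) S' :
  adjoint_pair S S' -> S 0 = 0.
Proof. by move=> h; apply: inner_self0; rewrite h inner0l. Qed.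

Lemma adjoint_pairD (R : realType) (H K : hilbertType R) (S : H -> K) S' x y :
  adjoint_pair S S' -> S (x + y) = S x + S y.
Proof.
move=> /adjoint_pair_sym h; apply: inner_ext => z.
by rewrite innerDr -!h innerDr.
Qed.

(** * Reducing subspaces and closed images *)

Definition reduces (R : realType) (H : hilbertType R) (F : set H)
    (S : H -> H) :=
  (forall x, F x -> F (S x)) /\ (forall x, orth F x -> orth F (S x)).

Lemma reduces_adj (R : realType) (H : hilbertType R) (F : set H)
    (S S' : H -> H) :
  adjoint_pair S S' ->
  (forall x, F x -> F (S x)) -> (forall x, F x -> F (S' x)) ->
  reduces F S.
Proof.
by move=> h hS hS'; split=> // x ox y Fy; rewrite h ox //; exact: hS'.
Qed.

Lemma reduces_iter (R : realType) (H : hilbertType R) (F : set H)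
    (S : H -> H) k :
  reduces F S -> reduces F (iter k S).
Proof.
move=> [h1 h2]; elim: k => [|k [IH1 IH2]]; split=> // x hx; rewrite iterS.
  by apply: h1; exact: IH1.
by apply: h2; exact: IH2.
Qed.

Lemma proj_uniq (R : realType) (H : hilbertType R) (F : set H) (x p q : H) :
  closed_subspace F -> F p -> F q -> orth F (x - p) -> orth F (x - q) -> p = q.
Proof.
move=> cF Fp Fq op oq; apply/eqP; rewrite -subr_eq0; apply/eqP/inner_self0.
have Fpq := subspaceB cF Fp Fq.
have E : p - q = (x - q) - (x - p) by rewrite opprB [RHS]addrC addrA subrK.
by rewrite {1}E innerBl op // oq // subrr.
Qed.

Lemma orth_self (R : realType) (H : hilbertType R) (F : set H) (x : H) :
  F x -> orth F x -> x = 0.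
Proof. by move=> Fx /(_ x Fx)/inner_self0. Qed.

(** If [p] is the projection of [x], then [S (x - p)] lies both in [F] and in its orthogonal
    complement, so it vanishes. *)
Lemma reduces_reflect (R : realType) (H : hilbertType R) (F : set H)
    (S : {linear H -> H}) (x : H) :
  closed_subspace F -> reduces F S -> injective S -> F (S x) -> F x.
Proof.
move=> cF [h1 h2] Sinj FSx; have [p Fp op] := projection x cF.
suff /eqP : x - p = 0 by rewrite subr_eq0 => /eqP ->.
apply: Sinj; rewrite linear0; apply: (@orth_self _ _ F); last exact: h2.
by rewrite linearB; apply: subspaceB => //; exact: h1.
Qed.

(** The lower bound turns a convergent sequence of images into a Cauchy sequence of preimages. *)
Lemma closed_image (R : realType) (H : hilbertType R) (F : set H)
    (S : {linear H -> H}) (d : R) :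
  0 < d -> (forall x, d * sqn x <= sqn (S x)) ->
  (forall x, sqn (S x) <= sqn x) ->
  closed_subspace F -> closed_subspace (S @` F).
Proof.
move=> d0 hd hS [F0 FL Fcl]; split=> [|a _ _ [x Fx <-] [y Fy <-]|x hx].
- by exists 0 => //; rewrite linear0.
- by exists (a *: x + y); [exact: FL|rewrite linearP].
have /choice[y hy] : forall m, exists y, F y /\ sqn (x - S y) < m.+1%:R^-1.
  by move=> m; have [|_ [y Fy <-] xy] := hx m.+1%:R^-1;
    [rewrite invr_gt0|exists y].
have [|l hl] := @hilbert_complete _ H y.
  move=> e e0; have [|N hN] := @invSn_lt _ (d * e / 4);
    first by rewrite !divr_gt0 ?mulr_gt0.
  exists N => p q /hN hp /hN hq.
  rewrite -(ltr_pM2l d0); apply: le_lt_trans (hd _) _; rewrite linearB.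
  apply: le_lt_trans (sqn_triangle _ x _) _; rewrite (sqn_subC _ x).
  have := lt_trans (hy p).2 hp; have := lt_trans (hy q).2 hq.
  by lra.
exists l.
  by apply: Fcl => e /hl[N hN]; exists (y N); [exact: (hy N).1|exact: hN].
apply/esym/eqP; rewrite -subr_eq0; apply/eqP/sqn_eq0/eqP.
rewrite eq_le sqn_ge0 andbT; apply/ler_addgt0Pl => e e0; rewrite addr0.
have e4 : 0 < e / 4 by lra.
have [N hN] := invSn_lt e4; have [M hM] := hl _ e4.
apply: le_trans (sqn_triangle _ (S (y (maxn N M))) _) _.
rewrite -linearB.
have := lt_trans (hy _).2 (hN _ (leq_maxl N M)).
have := le_lt_trans (hS _) (hM _ (leq_maxr N M)).
by rewrite !linearB [sqn (S (y _) - _)]sqn_subC; lra.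
Qed.

(** * Joint decomposition of a doubly twisted near-isometry *)

(* [Ge m], the range of [T_i^m], is not a piece of the decomposition.  It is
   there so that [T_{A^c}^l W_A] is again a joint space, with [Ge (l i)] at the
   indices outside [A]; intersecting over [l] turns these into [Inf]. *)
Inductive slot := Ex of nat | Ge of nat | Inf.

Definition shift (k : nat) (s : slot) : slot :=
  match s with Ex m => Ex (k + m) | Ge m => Ge (k + m) | Inf => Inf end.

(** The label of the piece T_A^k D_A(T). The exponent map is total, and its values outside [A] are
    discarded. *)
Definition slots (n : nat) (A : {set 'I_n}) (k : 'I_n -> nat)
    (i : 'I_n) : slot :=
  if i \in A then Ex (k i) else Inf.

(* [tuple_pow] for an arbitrary list of indices, with total exponent maps. *)
Definition list_pow (R : realType) (H : hilbertType R) (n : nat)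
    (T : 'I_n -> {linear H -> H}) (s : seq 'I_n) (k : 'I_n -> nat) : H -> H :=
  foldr (fun i g => iter (k i) (T i) \o g) id s.

(* The twist picked up when [T j] is pushed through [list_pow T s k], up to the
   factor [j] if [s] contains it. *)
Definition list_twist (R : realType) (H : hilbertType R) (n : nat)
    (U : 'I_n -> 'I_n -> {linear H -> H}) (j : 'I_n) (s : seq 'I_n)
    (k : 'I_n -> nat) : H -> H :=
  foldr (fun i g => if i == j then id else iter (k i) (twist U j i) \o g) id s.

Lemma eq_list_pow (R : realType) (H : hilbertType R) (n : nat)
    (T : 'I_n -> {linear H -> H}) (s : seq 'I_n) (k l : 'I_n -> nat) :
  {in s, k =1 l} -> list_pow T s k = list_pow T s l.
Proof.
elim: s => //= i s IH h; rewrite h ?mem_head // IH // => j js.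
by apply: h; rewrite inE js orbT.
Qed.

Lemma tuple_pow_list (R : realType) (H : hilbertType R) (n : nat)
    (T : 'I_n -> {linear H -> H}) (A : {set 'I_n}) (k : 'I_n -> nat) :
  tuple_pow T (fun i : 'I_#|A| => k (enum_val i)) = list_pow T (enum A) k.
Proof.
rewrite /tuple_pow /list_pow.
have -> : enum A = [seq enum_val i | i <- index_enum 'I_#|A|].
  (* [enum_val_nth] needs a default element; when [A] is empty both lists are empty. *)
  have [x0 _|A0] := pickP [in A]; last first.
    have c0 : #|A| = 0%N by apply: eq_card0 => i; exact: A0.
    have /size0nil -> : size (enum A) = 0%N by rewrite -cardE.
    by case: (index_enum _) => // i; have := A0 (enum_val i);
      rewrite /= enum_valP.
  rewrite (eq_map (enum_val_nth x0)) (map_comp (nth x0 (enum A)) val).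
  by rewrite -[index_enum _]enumT val_enum_ord cardE map_nth_iota0 // take_size.
by rewrite unlock /=; elim: (index_enum _) => //= i s ->.
Qed.

Lemma exponent_ext (n : nat) (A : {set 'I_n}) (k : 'I_#|A| -> nat) :
  exists l : 'I_n -> nat, k = fun i => l (enum_val i).
Proof.
exists (fun i => if [pick a | enum_val a == i] is Some a then k a else 0%N).
apply/funext => i; case: pickP => [a /eqP/enum_val_inj -> //|/(_ i)].
by rewrite eqxx.
Qed.

Lemma list_pow_adjoint (R : realType) (H : hilbertType R) (n : nat)
    (T : 'I_n -> {linear H -> H}) (s : seq 'I_n) (k : 'I_n -> nat) :
  (forall i, adjoint_pair (T i) (adj (T i))) ->
  adjoint_pair (list_pow T s k) (adj (list_pow T s k)).
Proof.
move=> h; suff [S hS] : exists S, adjoint_pair (list_pow T s k) S.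
  by rewrite (adj_eq hS).
elim: s => [|i s [S hS]]; first by exists id.
exists (S \o iter (k i) (adj (T i))).
exact: adjoint_pair_comp (adjoint_pair_iter _ (h i)) hS.
Qed.

Section Twisted.
Variables (R : realType) (n : nat) (H : hilbertType R).
Variables (T : 'I_n -> {linear H -> H}) (U : 'I_n -> 'I_n -> {linear H -> H}).
Hypothesis hT : doubly_twisted T U.
Local Notation u := (twist U).
Local Notation Ts i := (adj (T i)).

(** * Bounds, adjoints and commutation relations *)

Lemma near_isometry_sqn (S : {linear H -> H}) : near_isometry S ->
  (exists2 d : R, 0 < d & forall x, d * sqn x <= sqn (S x)) /\
  (forall x, sqn (S x) <= sqn x).
Proof.
move=> [[d d0 hd] _]; split.
  exists (d ^+ 2) => [|x]; first exact: exprn_gt0.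
  rewrite -lecR rmorphM rmorphXn /= -!sqn_normE -exprMn ler_pXn2r ?nnegrE //.
    exact: (hd x).1.
  by rewrite mulr_ge0 // ler0c ltW.
move=> x; rewrite -lecR -!sqn_normE ler_pXn2r ?nnegrE //; exact: (hd x).2.
Qed.

Lemma T_bound i x : sqn (T i x) <= sqn x.
Proof. by case: hT => /(_ i)/near_isometry_sqn[]. Qed.

Lemma T_below i : exists2 d : R, 0 < d & forall x, d * sqn x <= sqn (T i x).
Proof. by case: hT => /(_ i)/near_isometry_sqn[]. Qed.

Lemma T_inj i : injective (T i).
Proof.
move=> x y /eqP; rewrite -subr_eq0 -linearB => /eqP h.
have [d d0 /(_ (x - y))] := T_below i; rewrite h sqn0 pmulr_rle0 // => h1.
apply/eqP; rewrite -subr_eq0; apply/eqP/sqn_eq0/eqP.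
by rewrite eq_le h1 sqn_ge0.
Qed.

Lemma iterT_inj i k : injective (iter k (T i)).
Proof. by elim: k => // k IH x y; rewrite !iterS => /T_inj/IH. Qed.

Lemma T_adj i : adjoint_pair (T i) (Ts i).
Proof. exact/adjointP/T_bound. Qed.

Lemma twist_adj i j : i != j -> adjoint_pair (u i j) (u j i).
Proof.
case: hT => _ hU _ _; rewrite /twist.
case: ltngtP => // [ij _|ij _|/val_inj ->]; last by rewrite eqxx.
  by have [] := unitary_adjP (hU _ _ ij).
by apply: adjoint_pair_sym; have [] := unitary_adjP (hU _ _ ij).
Qed.

Lemma twistK i j : i != j -> cancel (u i j) (u j i).
Proof.
case: hT => _ hU _ _; rewrite /twist.
by case: ltngtP => // [ij _|ij _|/val_inj ->]; last (by rewrite eqxx);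
  have [] := unitary_adjP (hU _ _ ij).
Qed.

(** For [j < i] the twist is the inverse of [U j i], and commutation with [T k] passes to the
    inverse. *)
Lemma T_twist i j k x : i != j -> T k (u i j x) = u i j (T k x).
Proof.
move=> ij; have ji : j != i by rewrite eq_sym.
case: hT => _ _ _ hR; have [lij|lji|/val_inj e] := ltngtP i j.
- by have [_ + _] := hR _ _ lij; rewrite /twist lij => /(_ k x).
- have [_ h _] := hR _ _ lji.
  have {}h y : T k (u j i y) = u j i (T k y) by rewrite /twist lji; exact: h.
  by apply: (can_inj (twistK ji)); rewrite -h !twistK.
- by rewrite e eqxx in ij.
Qed.

Lemma adjT_twist i j k x : i != j -> Ts k (u i j x) = u i j (Ts k x).
Proof.
move=> ij; have ji : j != i by rewrite eq_sym.
apply: inner_ext => z.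
by rewrite -T_adj -!(twist_adj ji) -T_twist // T_adj.
Qed.

Lemma T_comm i j x : i != j -> T i (T j x) = u i j (T j (T i x)).
Proof.
move=> ij; have ji : j != i by rewrite eq_sym.
case: hT => _ _ _ hR; have [lij|lji|/val_inj e] := ltngtP i j.
- by have [_ _ +] := hR _ _ lij; rewrite /twist lij => /(_ x).
- have [_ _ /(_ x) /= h] := hR _ _ lji.
  have {}h : T j (T i x) = u j i (T i (T j x)) by rewrite /twist lji.
  by rewrite h twistK.
- by rewrite e eqxx in ij.
Qed.

(** The defining relation covers [i < j]; the opposite order follows by taking adjoints. *)
Lemma adjT_T_comm i j x : i != j -> Ts i (T j x) = u j i (T j (Ts i x)).
Proof.
have lt_case (a b : 'I_n) y : (a < b)%N -> Ts a (T b y) = u b a (T b (Ts a y)).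
  move=> lab; case: hT => _ _ _ /(_ _ _ lab)[/(_ y) /= -> _ _].
  by rewrite /twist ltnNge (ltnW lab).
move=> ij; have ji : j != i by rewrite eq_sym.
have [lij|lji|/val_inj e] := ltngtP i j.
- exact: lt_case.
- apply: inner_ext => z.
  rewrite -T_adj -(adjoint_pair_sym (@T_adj j)) lt_case //.
  by rewrite twist_adj // T_adj (adjoint_pair_sym (@T_adj j)) adjT_twist //
    T_twist.
- by rewrite e eqxx in ij.
Qed.

Lemma adjT_comm i j x : i != j -> Ts i (Ts j x) = u i j (Ts j (Ts i x)).
Proof.
move=> ij; have ji : j != i by rewrite eq_sym.
apply: inner_ext => z.
by rewrite -!T_adj (T_comm _ ji) twist_adj // !T_adj !adjT_twist.
Qed.

(** * Wold pieces of a single operator of the tuple *)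

Definition slot_space (i : 'I_n) (s : slot) : set H :=
  match s with
  | Ex m => iter m (T i) @` [set x | Ts i x = 0]
  | Ge m => range (iter m (T i))
  | Inf => \bigcap_m range (iter m (T i))
  end.

(** Treats [T j], [adj (T j)] and the twists uniformly. Since [v] commutes with [T i], moving [Q]
    past [iter m (T i)] leaves [iter m v] behind, and both [Q] and [v] preserve the kernel of
    [adj (T i)]. *)
Lemma slot_space_stable i s (Q v : H -> H) :
  (forall x, Q (T i x) = v (T i (Q x))) -> (forall x, T i (v x) = v (T i x)) ->
  (forall x, Ts i x = 0 -> Ts i (Q x) = 0) ->
  (forall x, Ts i x = 0 -> Ts i (v x) = 0) ->
  forall x, slot_space i s x -> slot_space i s (Q x).
Proof.
move=> QT Tv Qk vk.
have QTm m x : Q (iter m (T i) x) = iter m (T i) (iter m v (Q x)).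
  have vT k y : v (iter k (T i) y) = iter k (T i) (v y).
    by elim: k => // k IH; rewrite !iterS -Tv IH.
  by elim: m => // m IH; rewrite iterS QT IH -Tv vT !iterS.
case: s => [m|m|] x /=.
- case=> w Tsw <-; rewrite QTm; exists (iter m v (Q w)) => //=.
  by elim: m {QTm} => [|m IH]; [exact: Qk|rewrite iterS; exact: vk].
- by case=> w _ <-; rewrite QTm; exists (iter m v (Q w)).
- by move=> hx m _; have [w _ <-] := hx m I; rewrite QTm;
    exists (iter m v (Q w)).
Qed.

Lemma slot_space_T i j s x : i != j -> slot_space i s x ->
  slot_space i s (T j x).
Proof.
move=> ij; have ji : j != i by rewrite eq_sym.
apply: (@slot_space_stable _ _ _ (u j i)) => y.
- exact: T_comm.
- exact: T_twist.
- by move=> h; rewrite adjT_T_comm // h linear0 (adjoint_pair0 (twist_adj ji)).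
- by move=> h; rewrite adjT_twist // h (adjoint_pair0 (twist_adj ji)).
Qed.

Lemma slot_space_adjT i j s x : i != j -> slot_space i s x ->
  slot_space i s (Ts j x).
Proof.
move=> ij; have ji : j != i by rewrite eq_sym.
apply: (@slot_space_stable _ _ _ (u i j)) => y.
- exact: adjT_T_comm.
- exact: T_twist.
- move=> h; rewrite adjT_comm // h.
  rewrite (adjoint_pair0 (adjoint_pair_sym (@T_adj j))).
  by rewrite (adjoint_pair0 (twist_adj ij)).
- by move=> h; rewrite adjT_twist // h (adjoint_pair0 (twist_adj ij)).
Qed.

Lemma slot_space_twist i s a b x : a != b -> slot_space i s x ->
  slot_space i s (u a b x).
Proof.
move=> ab; apply: (@slot_space_stable _ _ _ id) => y //;
  first by rewrite T_twist.
by move=> h; rewrite adjT_twist // h (adjoint_pair0 (twist_adj ab)).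
Qed.

Lemma slot_space_reduces i j s : i != j -> reduces (slot_space i s) (T j).
Proof.
move=> ij; apply: (reduces_adj (@T_adj j)) => x;
  [exact: slot_space_T|exact: slot_space_adjT].
Qed.

Lemma slot_space_reduces_adj i j s : i != j -> reduces (slot_space i s) (Ts j).
Proof.
move=> ij; apply: (reduces_adj (adjoint_pair_sym (@T_adj j))) => x.
  exact: slot_space_adjT.
exact: slot_space_T.
Qed.

Lemma ker_adjE i : [set x | Ts i x = 0] = orth (range (T i)).
Proof.
apply/seteqP; split=> x /=.
  by move=> h _ [y _ <-]; rewrite -(adjoint_pair_sym (@T_adj i)) h inner0l.
by move=> h; apply: inner_self0; rewrite (adjoint_pair_sym (@T_adj i)) h.
Qed.

Lemma closed_iter_image i m (F : set H) :
  closed_subspace F -> closed_subspace (iter m (T i) @` F).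
Proof.
move=> cF; elim: m => [|m IH]; first by rewrite image_id.
have [d d0 hd] := T_below i.
have -> : iter m.+1 (T i) @` F = T i @` (iter m (T i) @` F).
  by rewrite image_comp.
exact: (closed_image d0 hd (@T_bound i)).
Qed.

Lemma closed_slot_space i s : closed_subspace (slot_space i s).
Proof.
have cT : closed_subspace [set: H] by [].
case: s => [m|m|] /=; try exact: closed_iter_image.
  by apply: closed_iter_image; rewrite ker_adjE; exact: orth_closed.
have c m := closed_iter_image i m cT.
split=> [m _|a x y hx hy m _|x hx m _]; have [c0 cL ccl] := c m.
- exact: c0.
- by apply: cL; [exact: hx|exact: hy].
- by apply: ccl => e /hx[y /(_ m I) hy xy]; exists y.
Qed.

Lemma slot_space_shift i k s :
  slot_space i (shift k s) = iter k (T i) @` slot_space i s.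
Proof.
have comp m (F : set H) :
    iter (k + m) (T i) @` F = iter k (T i) @` (iter m (T i) @` F).
  by rewrite image_comp; congr (image F); apply/funext => x /=; rewrite iterD.
case: s => [m|m|] /=; try exact: comp.
apply/seteqP; split=> x /=.
  move=> hx; have [y _ xE] := hx k I; exists y => // m _.
  (* Since [T i] is injective, [k] factors cancel from the representation of [x] with exponent
     [k + m]. *)
  have [z _] := hx (k + m)%N I; rewrite iterD -xE => /iterT_inj <-.
  by exists z.
case=> y hy <- m _; have [z _ <-] := hy m I.
by exists (iter k (T i) z) => //; rewrite -!iterD addnC.
Qed.

(** Rests on the second near-isometry condition: after [m] adjoints are moved over, [y] becomes an
    element of the range of [T i], which is orthogonal to the kernel of [adj (T i)]. *)
Lemma Ex_Ge_orth i m p x y : (m < p)%N -> slot_space i (Ex m) x ->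
  slot_space i (Ge p) y -> inner x y = 0.
Proof.
move=> mp [w hw <-] [h _ <-].
rewrite -(subnKC mp) iterD.
have ai := adjoint_pair_iter m (@T_adj i).
rewrite ai; have [_ hN] : near_isometry (T i) by case: hT.
set h' := iter (p - m.+1) (T i) h.
have [g _ <-] : range (T i) (iter m (Ts i) (iter m.+1 (T i) h')).
  by apply: (hN m); exists h'.
by rewrite -(adjoint_pair_sym (@T_adj i)) hw inner0l.
Qed.

Definition slot_disj (s s' : slot) : Prop :=
  match s, s' with
  | Ex m, Ex m' => m <> m'
  | Ex _, Inf | Inf, Ex _ => True
  | _, _ => False
  end.

Lemma slot_space_disj i s s' x y : slot_disj s s' -> slot_space i s x ->
  slot_space i s' y -> inner x y = 0.
Proof.
have sub m z : slot_space i (Ex m) z -> slot_space i (Ge m) z.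
  by case=> w _ <-; exists w.
case: s => [m|m|]; case: s' => [m'|m'|] //=.
- move=> /eqP; rewrite neq_ltn => /orP[lt|lt] hx hy.
    exact: (Ex_Ge_orth lt hx (sub _ _ hy)).
  exact: inner_eq0C (Ex_Ge_orth lt hy (sub _ _ hx)).
- by move=> _ hx hy; exact: (Ex_Ge_orth (ltnSn m) hx (hy m.+1 I)).
- by move=> _ hx hy; exact: inner_eq0C (Ex_Ge_orth (ltnSn m') hy (hx m'.+1 I)).
Qed.

(** Totality of the Wold pieces, by induction on the exponent. Write [x] as T_i^m y and split [y] as
    [w + T i h] with [w] in the kernel of the adjoint; T_i^m w is orthogonal to [x] and to T_i^(m+1)
    h, hence zero. *)
Lemma orth_Ex_Inf i x : (forall m, orth (slot_space i (Ex m)) x) ->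
  slot_space i Inf x.
Proof.
move=> hx m _; elim: m => [|m [y _ yx]]; first by exists x.
have cR : closed_subspace (range (T i)) := closed_slot_space i (Ge 1).
have [_ [h _ <-] oh] := projection y cR.
have kw : Ts i (y - T i h) = 0.
  by have : orth (range (T i)) (y - T i h) := oh; rewrite -ker_adjE.
set w := y - T i h in kw.
have Ew : slot_space i (Ex m) (iter m (T i) w) by exists w.
have xE : x = iter m (T i) w + iter m.+1 (T i) h.
  rewrite -yx -[y](subrK (T i h)) -/w iterSr.
  exact: (adjoint_pairD _ _ (adjoint_pair_iter m (@T_adj i))).
have := hx m _ Ew.
have Gh : slot_space i (Ge m.+1) (iter m.+1 (T i) h) by exists h.
rewrite xE innerDl (inner_eq0C (Ex_Ge_orth (ltnSn m) Ew Gh)) addr0.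
by move=> /inner_self0 ->; rewrite add0r; exists h.
Qed.

(** * Joint spaces and the subspaces D_A(T) *)

Definition joint_space (m : 'I_n -> slot) : set H :=
  [set x | forall i, slot_space i (m i) x].

Lemma slot_space_reflect i j s k x : i != j ->
  slot_space i s (iter k (T j) x) -> slot_space i s x.
Proof.
move=> ij; elim: k => // k IH; rewrite iterS => h; apply: IH.
exact: (reduces_reflect (closed_slot_space i s) (slot_space_reduces s ij)
  (@T_inj j) h).
Qed.

(** Only slot [i] moves: for [j != i] the operator [T i] reduces the slot space at [j] and is
    injective, so it both preserves and reflects membership. *)
Lemma joint_space_iter i k m :
  iter k (T i) @` joint_space m =
  joint_space (fun j => if j == i then shift k (m j) else m j).
Proof.
apply/seteqP; split=> x.
  move=> [y hy <-] j; have [->|ji] := eqVneq j i.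
    by rewrite slot_space_shift; exists y.
  by apply: (reduces_iter k (slot_space_reduces (m j) ji)).1; exact: hy.
move=> hx; have := hx i; rewrite /= eqxx slot_space_shift => -[y hy yx].
exists y => // j; have [->//|ji] := eqVneq j i.
by have := hx j; rewrite /= (negPf ji) -yx; exact: slot_space_reflect.
Qed.

Lemma joint_space_list_pow s k m : uniq s ->
  list_pow T s k @` joint_space m =
  joint_space (fun i => if i \in s then shift (k i) (m i) else m i).
Proof.
elim: s => [|a s IH] /=; first by rewrite image_id.
move=> /andP[nas us].
have -> : (iter (k a) (T a) \o list_pow T s k) @` joint_space m =
    iter (k a) (T a) @` (list_pow T s k @` joint_space m) by rewrite image_comp.
rewrite IH // joint_space_iter; congr joint_space; apply/funext => i;
  rewrite inE.
by have [->|ia] := eqVneq i a; rewrite ?(negPf nas).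
Qed.

Lemma wanderingE A :
  wandering T A = joint_space (fun i => if i \in A then Ex 0 else Ge 0).
Proof.
apply/seteqP; split=> x h i.
  by case: ifPn => iA; exists x => //; exact: h.
by move=> iA; have := h i; rewrite /= iA => -[w hw <-].
Qed.

Lemma DspaceE A : Dspace T A = joint_space (slots A (fun=> 0%N)).
Proof.
have e (l : 'I_n -> nat) :
    tuple_pow T (fun i : 'I_#|(~: A)%SET| => l (enum_val i)) @` wandering T A =
    joint_space (fun i => if i \in A then Ex 0 else Ge (l i)).
  rewrite tuple_pow_list wanderingE joint_space_list_pow ?enum_uniq //;
    congr joint_space; apply/funext => i.
  by rewrite mem_enum inE; case: (i \in A); rewrite //= addn0.
apply/seteqP; split=> x.
  move=> hx i; rewrite /slots; case: ifPn => iA.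
    have := hx (fun=> 0%N) I; rewrite (e (fun=> 0%N)) => /(_ i).
    by rewrite iA.
  (* Constant exponent families already force membership in [Inf]. *)
  move=> m _; have := hx (fun=> m) I; rewrite (e (fun=> m)) => /(_ i).
  by rewrite (negPf iA).
move=> hx l _; have [k ->] := exponent_ext l; rewrite e => i.
by have := hx i; rewrite /slots; case: ifP => // _ /(_ (k i) I).
Qed.

Lemma list_pow_Dspace A k :
  list_pow T (enum A) k @` Dspace T A = joint_space (slots A k).
Proof.
rewrite DspaceE joint_space_list_pow ?enum_uniq //; congr joint_space;
  apply/funext => i.
by rewrite mem_enum /slots; case: (i \in A); rewrite //= addn0.
Qed.

(** Distinct labels differ at some index, and as labels contain no [Ge], the two slots there are
    disjoint. *)
Lemma piece_orth A k B l x y : slots A k <> slots B l ->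
  joint_space (slots A k) x -> joint_space (slots B l) y -> inner x y = 0.
Proof.
move=> neq hx hy.
have [i hi] : exists i, slots A k i <> slots B l i.
  by apply/existsNP => h; apply: neq; exact/funext.
apply: slot_space_disj (hx i) (hy i).
move: hi; rewrite /slots; case: ifP => _; case: ifP => _ //= h.
by move=> e; apply: h; rewrite e.
Qed.

Lemma reduces_list_pow i t s k : i \notin s ->
  reduces (slot_space i t) (list_pow T s k).
Proof.
elim: s => [|a s IH]; first by move=> _; split.
rewrite inE negb_or => /andP[ia /IH [h1 h2]].
have [g1 g2] := reduces_iter (k a) (slot_space_reduces t ia).
by split=> x hx; [apply: g1; exact: h1|apply: g2; exact: h2].
Qed.

(** At indices in [A] the vector is tested against the range of [T i]; at the others it is tested
    against the orthogonal complement of the [Inf] slot, which the power reduces. *)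
Lemma Dspace_gram A k x : Dspace T A x ->
  Dspace T A (adj (list_pow T (enum A) k) (list_pow T (enum A) k x)).
Proof.
have aS := list_pow_adjoint (enum A) k (@T_adj).
move=> Dx; have Sx : joint_space (slots A k) (list_pow T (enum A) k x).
  by rewrite -list_pow_Dspace; exists x.
rewrite DspaceE => i; have := Sx i; rewrite /slots; case: ifPn => iA Ei.
  eexists; last by []; apply: inner_self0.
  rewrite (adjoint_pair_sym (@T_adj i)) (adjoint_pair_sym aS).
  set z := T i _.
  (* These slots record only that [z] is in the range of [T i], as [Ge 0] is no constraint. The
     power raises slot [i] to [Ge (k i + 1)], one above the exact exponent [k i]. *)
  pose m j := if j == i then Ge 1 else Ge 0.
  have : joint_space (fun j => if j \in enum A then shift (k j) (m j) else m j)
      (list_pow T (enum A) k z).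
    rewrite -joint_space_list_pow ?enum_uniq //.
    exists z => // j; rewrite /m; case: eqP => [->|_]; last by exists z.
    by rewrite /z; eexists.
  move=> /(_ i); rewrite mem_enum iA /m eqxx => Gi.
  by apply: (Ex_Ge_orth _ Ei Gi); rewrite addn1.
apply: orth_orth; first exact: closed_slot_space.
move=> y oy; rewrite (adjoint_pair_sym aS).
have niA : i \notin enum A by rewrite mem_enum.
exact: inner_eq0C ((reduces_list_pow Inf k niA).2 _ oy _ Ei).
Qed.

Lemma Dspace_twist A a b x : a != b -> Dspace T A x -> Dspace T A (u a b x).
Proof.
by move=> ab; rewrite DspaceE => hx i; apply: slot_space_twist => //; exact: hx.
Qed.

Lemma Dspace_T (A : {set 'I_n}) j x : j \notin A -> Dspace T A x ->
  Dspace T A (T j x).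
Proof.
move=> jA; rewrite DspaceE => hx i; have [->|ij] := eqVneq i j.
  have := hx j; rewrite /slots (negPf jA) => h.
  (* [shift 1 Inf] computes to [Inf], so [T j] maps its infinite slot onto itself. *)
  by rewrite -[Inf]/(shift 1 Inf) slot_space_shift; exists x.
by apply: slot_space_T => //; exact: hx.
Qed.

(** * Totality of the joint pieces *)

Lemma slot_space_proj i j s s' z p : i != j -> slot_space j s' z ->
  slot_space i s p -> orth (slot_space i s) (z - p) -> slot_space j s' p.
Proof.
move=> ij hz hp op; have cE := closed_slot_space i s.
(* As [T j] reduces the slot space at [i], projecting onto it commutes with powers of [T j]: the
   projection [q] of [v] is sent to the projection [p] of [z]. *)
have key m v : iter m (T j) v = z -> exists q,
    [/\ iter m (T j) q = p, slot_space i s q & orth (slot_space i s) (v - q)].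
  move=> vz; have [q Eq oq] := projection v cE; exists q; split=> //.
  have [r1 r2] := reduces_iter m (slot_space_reduces s ij).
  apply: (@proj_uniq _ _ _ z _ _ cE) => //; first exact: r1.
  rewrite -vz -{1}[v](subrK q).
  rewrite (adjoint_pairD _ _ (adjoint_pair_iter m (@T_adj j))).
  by rewrite addrK; exact: r2.
case: s' hz => [m|m|].
- move=> [v kv /key[q [qp Eq oq]]]; exists q => //=.
  apply: (@orth_self _ _ (slot_space i s)); first exact: slot_space_adjT.
  (* Since [v] is in the kernel, [Ts j q] lies in the slot space and, by this identity, also in its
     orthogonal complement. *)
  have -> : Ts j q = - Ts j (v - q).
    apply/eqP; rewrite -addr_eq0.
    rewrite -(adjoint_pairD _ _ (adjoint_pair_sym (@T_adj j))).
    rewrite [q + _]addrC subrK.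
    exact/eqP.
  rewrite -scaleN1r; apply: (subspaceZ _ (orth_closed _)).
  exact: (slot_space_reduces_adj s ij).2.
- by move=> [v _ /key[q [qp _ _]]]; exists q.
- by move=> h m _; have [v _ /key[q [qp _ _]]] := h m I; exists q.
Qed.

(* [z] is the image of [y] under the successive projections onto the slots of
   the indices in [s], chosen so that it never vanishes. *)
Lemma pieces_total_step (s : seq 'I_n) y : uniq s -> y != 0 ->
  exists A k z, [/\ z != 0, forall i, i \in s -> slot_space i (slots A k i) z
    & forall x, (forall i, i \in s -> slot_space i (slots A k i) x) ->
      inner (y - z) x = 0].
Proof.
move=> + y0; elim: s => [_|i s IH /= /andP[nis /IH [A [k [z [z0 Ez oz]]]]]].
  by exists finset.set0, (fun=> 0%N), y; split=> // x _; rewrite subrr inner0l.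
have ins j : j \in s -> j != i by apply: contraTneq => ->.
(* If [z] is orthogonal to every exact slot at [i], it is already in [Inf]; [i] is then removed from
   [A] and [z] is kept. Otherwise some exact slot gives a nonzero projection. *)
have [h|/existsNP[m /existsNP[w /not_implyP[Ew zw]]]] :=
    pselect (forall m, orth (slot_space i (Ex m)) z).
  exists (A :\ i)%SET, k, z.
  have sE j : j \in s -> slots (A :\ i)%SET k j = slots A k j.
    by move=> /ins ji; rewrite /slots in_setD1 ji.
  split=> // [j|x hx].
    rewrite inE => /orP[/eqP ->|js]; last by rewrite sE //; exact: Ez.
    by rewrite /slots in_setD1 eqxx; exact: orth_Ex_Inf.
  by apply: oz => j js; rewrite -sE //; apply: hx; rewrite inE js orbT.
have [p Ep op] := projection z (closed_slot_space i (Ex m)).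
pose k' j := if j == i then m else k j.
have sE j : j \in s -> slots (i |: A)%SET k' j = slots A k j.
  by move=> /ins ji; rewrite /slots in_setU1 /k' (negPf ji).
have sEi : slots (i |: A)%SET k' i = Ex m by rewrite /slots in_setU1 /k' eqxx.
exists (i |: A)%SET, k', p; split=> [|j|x hx].
- apply/eqP => p0; apply: zw; move: op; rewrite p0 subr0; exact.
- rewrite inE => /orP[/eqP ->|js]; first by rewrite sEi.
  by rewrite sE //; apply: (slot_space_proj _ (Ez _ js) Ep op); rewrite eq_sym ins.
- have -> : y - p = (y - z) + (z - p) by rewrite addrA subrK.
  rewrite innerDl op ?addr0; last by rewrite -sEi; apply: hx; rewrite mem_head.
  by apply: oz => j js; rewrite -sE //; apply: hx; rewrite inE js orbT.
Qed.

(** A nonzero [y] would yield a nonzero [z] in a piece with [y - z] orthogonal to it, so that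
    [inner y z] equals [inner z z]. *)
Lemma pieces_total y :
  (forall A k x, joint_space (slots A k) x -> inner y x = 0) -> y = 0.
Proof.
move=> h; apply/eqP; apply: contraT => y0.
have [A [k [z [z0 Ez oz]]]] := pieces_total_step (enum_uniq 'I_n) y0.
have Mz : joint_space (slots A k) z by move=> i; apply: Ez; rewrite mem_enum.
have := oz z (fun i _ => Mz i); rewrite innerBl (h _ _ _ Mz) sub0r => /eqP.
by rewrite oppr_eq0 => /eqP/inner_self0/eqP; rewrite (negPf z0).
Qed.

(** * Moving T_j through T_A^k *)

Lemma iterT_twist i k a b x : a != b ->
  iter k (T i) (u a b x) = u a b (iter k (T i) x).
Proof. by move=> ab; elim: k => // k IH; rewrite !iterS IH T_twist. Qed.

Lemma list_pow_twist s k a b x : a != b ->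
  list_pow T s k (u a b x) = u a b (list_pow T s k x).
Proof. by move=> ab; elim: s => //= i s ->; rewrite iterT_twist. Qed.

Lemma T_iter i j k x : i != j ->
  T j (iter k (T i) x) = iter k (T i) (iter k (u j i) (T j x)).
Proof.
move=> ij; have ji : j != i by rewrite eq_sym.
have ui m y : u j i (iter m (T i) y) = iter m (T i) (u j i y).
  by rewrite iterT_twist.
by elim: k => // k IH; rewrite iterS T_comm // IH -iterS ui -iterS.
Qed.

Lemma T_list_pow_notin j s k x : j \notin s ->
  T j (list_pow T s k x) = list_pow T s k (T j (list_twist U j s k x)).
Proof.
elim: s x => // i s IH x; rewrite inE negb_or => /andP[ji js] /=.
have ij : i != j by rewrite eq_sym.
rewrite (negPf ij) T_iter // IH //=; congr iter.
by elim: (k i) => // m IHm; rewrite !iterS IHm T_twist // list_pow_twist.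
Qed.

(** Only the blocks ahead of [j] contribute twists: on reaching its own block [T j] is absorbed and
    raises the exponent, and [uniq s] ensures that no later block changes. *)
Lemma T_list_pow_in j s k x : uniq s -> j \in s ->
  T j (list_pow T s k x) =
  list_pow T s (fun i => if i == j then (k i).+1 else k i)
    (list_twist U j s k x).
Proof.
elim: s x => // i s IH x /= /andP[nis us]; rewrite inE.
have [-> _|ji /= js] := eqVneq j i.
  rewrite -iterS; congr iter; congr (_ x); apply: eq_list_pow => a ai.
  by case: eqP => // e; rewrite -e ai in nis.
have ij : i != j by rewrite eq_sym.
rewrite T_iter // IH //=; congr iter.
by elim: (k i) => // m IHm; rewrite !iterS IHm list_pow_twist.
Qed.

End Twisted.

(** * From unitary equivalence to the pieces *)

Lemma twist_intertwine (R : realType) (n : nat) (H K : hilbertType R)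
    (T : 'I_n -> {linear H -> H}) (U : 'I_n -> 'I_n -> {linear H -> H})
    (T' : 'I_n -> {linear K -> K}) (U' : 'I_n -> 'I_n -> {linear K -> K})
    (V : H -> K) :
  doubly_twisted T U -> doubly_twisted T' U' ->
  (forall i x, V (T i x) = T' i (V x)) ->
  forall i j x, i != j -> V (twist U i j x) = twist U' i j (V x).
Proof.
move=> hT hT' VT i j x ij.
apply: (T_inj hT' (i := i)); apply: (T_inj hT' (i := j)).
rewrite -!VT (T_twist hT) // (T_twist hT) // -(T_comm hT) //.
by rewrite (T_twist hT') // (T_twist hT') // -(T_comm hT') // !VT.
Qed.

Lemma list_pow_intertwine (R : realType) (n : nat) (H K : hilbertType R)
    (T : 'I_n -> {linear H -> H}) (T' : 'I_n -> {linear K -> K})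
    (V : H -> K) s k :
  (forall i x, V (T i x) = T' i (V x)) ->
  forall x, V (list_pow T s k x) = list_pow T' s k (V x).
Proof.
move=> VT; elim: s => //= i s IH x; rewrite -IH.
by elim: (k i) => // m IHm; rewrite !iterS VT IHm.
Qed.

(** Stated for a bare intertwining map, so that it applies to a unitary and to its adjoint, giving
    both inclusions for the image of D_A(T). *)
Lemma Dspace_intertwine (R : realType) (n : nat) (H K : hilbertType R)
    (T : 'I_n -> {linear H -> H}) (T' : 'I_n -> {linear K -> K})
    (V : H -> K) (A : {set 'I_n}) :
  V 0 = 0 -> (forall i x, V (T i x) = T' i (V x)) ->
  (forall i x, V (adj (T i) x) = adj (T' i) (V x)) ->
  forall x, Dspace T A x -> Dspace T' A (V x).
Proof.
move=> V0 VT VTs x Dx l _; have [k kE] := exponent_ext l.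
have := Dx l I; rewrite kE !tuple_pow_list => -[w hw <-].
exists (V w); last by rewrite (list_pow_intertwine _ _ VT).
by move=> i iA; rewrite -VTs hw.
Qed.

(** All requirements on one V_A in a single predicate, from which the family over [A] is chosen. *)
Definition piece_unitary (R : realType) (n : nat) (H K : hilbertType R)
    (T : 'I_n -> {linear H -> H}) (U : 'I_n -> 'I_n -> {linear H -> H})
    (T' : 'I_n -> {linear K -> K}) (U' : 'I_n -> 'I_n -> {linear K -> K})
    (A : {set 'I_n}) (V : H -> K) : Prop :=
  unitary_between (Dspace T A) (Dspace T' A) V /\
  [/\ forall (k : 'I_#|A| -> nat) (x : H), Dspace T A x ->
        V (adj (tuple_pow T k) (tuple_pow T k x)) =
        adj (tuple_pow T' k) (tuple_pow T' k (V x)),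
      forall (j : 'I_n) (x : H), j \notin A -> Dspace T A x ->
        V (T j x) = T' j (V x)
    & forall (i j : 'I_n) (x : H), i != j -> Dspace T A x ->
        V (twist U i j x) = twist U' i j (V x)].

Lemma equivalent_pieces (R : realType) (n : nat) (H K : hilbertType R)
    (T : 'I_n -> {linear H -> H}) (U : 'I_n -> 'I_n -> {linear H -> H})
    (T' : 'I_n -> {linear K -> K}) (U' : 'I_n -> 'I_n -> {linear K -> K})
    (A : {set 'I_n}) :
  doubly_twisted T U -> doubly_twisted T' U' -> unitarily_equivalent T T' ->
  exists V : H -> K, piece_unitary T U T' U' A V.
Proof.
move=> hT hT' [V uV hV]; have [Vadj VK KV] := unitary_adjP uV.
have [Vlin Viso _] := uV.
have VT i x : V (T i x) = T' i (V x) by rewrite -hV /= VK.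
have WT i x : adj V (T' i x) = T i (adj V x) by rewrite -hV /= VK.
(* A unitary that intertwines two operators also intertwines their adjoints; this serves for each
   [T i] and for the powers in (i). *)
have adjV (S S1 : H -> H) (Q Q1 : K -> K) x :
    adjoint_pair S S1 -> adjoint_pair Q Q1 ->
    (forall x, V (S x) = Q (V x)) -> V (S1 x) = Q1 (V x).
  move=> aS aQ VS; apply: inner_ext => y; rewrite -(KV y) -aQ -VS.
  by rewrite Viso // -aS Viso.
have VTs i x : V (adj (T i) x) = adj (T' i) (V x).
  exact: (adjV _ _ _ _ _ (T_adj hT i) (T_adj hT' i) (VT i)).
have WTs i x : adj V (adj (T' i) x) = adj (T i) (adj V x).
  by apply: (can_inj VK); rewrite VTs !KV.
have V0 : V 0 = 0 := adjoint_pair0 Vadj.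
have W0 : adj V 0 = 0 := adjoint_pair0 (adjoint_pair_sym Vadj).
exists V; split; split.
- by move=> a x y _ _; exact: Vlin.
- by move=> x y _ _; exact: Viso.
- apply/seteqP; split=> [_ [x Dx <-]|y Dy]; first exact: Dspace_intertwine Dx.
  by exists (adj V y); [exact: Dspace_intertwine Dy|exact: KV].
- move=> k x _; have [l ->] := exponent_ext k; rewrite !tuple_pow_list.
  rewrite -(list_pow_intertwine _ _ VT).
  apply: adjV; [exact: list_pow_adjoint (T_adj hT)
    |exact: list_pow_adjoint (T_adj hT')|].
  exact: list_pow_intertwine.
- by move=> j x _ _; exact: VT.
- by move=> i j x ij _; exact: (twist_intertwine hT hT').
Qed.

(** * From the pieces to unitary equivalence *)

Lemma list_twist_intertwine (R : realType) (n : nat) (H K : hilbertType R)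
    (T : 'I_n -> {linear H -> H}) (U : 'I_n -> 'I_n -> {linear H -> H})
    (U' : 'I_n -> 'I_n -> {linear K -> K}) (A : {set 'I_n})
    (V : H -> K) j s k x :
  doubly_twisted T U ->
  (forall (i j : 'I_n) (x : H), i != j -> Dspace T A x ->
     V (twist U i j x) = twist U' i j (V x)) ->
  Dspace T A x ->
  Dspace T A (list_twist U j s k x) /\
  V (list_twist U j s k x) = list_twist U' j s k (V x).
Proof.
(* Membership in D_A(T) is carried through the induction, as [Vu] is available only there. *)
move=> hT Vu Dx; elim: s => //= i s IH; have [//|ij] := eqVneq i j.
have ji : j != i by rewrite eq_sym.
have [D1 V1] := IH; elim: (k i) => //= m [D2 V2].
by split; [exact: (Dspace_twist hT)|rewrite Vu // V2].
Qed.

Theorem theorem9p4 (R : realType) (n : nat) (hn : (2 <= n)%N)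
    (H K : hilbertType R)
    (T : 'I_n -> {linear H -> H}) (U : 'I_n -> 'I_n -> {linear H -> H})
    (T' : 'I_n -> {linear K -> K}) (U' : 'I_n -> 'I_n -> {linear K -> K})
    (hT : doubly_twisted T U) (hT' : doubly_twisted T' U') :
  unitarily_equivalent T T' <->
  forall A : {set 'I_n}, exists2 V : H -> K,
    unitary_between (Dspace T A) (Dspace T' A) V &
    [/\ forall (k : 'I_#|A| -> nat) (x : H), Dspace T A x ->
          V (adj (tuple_pow T k) (tuple_pow T k x)) =
          adj (tuple_pow T' k) (tuple_pow T' k (V x)),
        forall (j : 'I_n) (x : H), j \notin A -> Dspace T A x ->
          V (T j x) = T' j (V x)
      & forall (i j : 'I_n) (x : H), i != j -> Dspace T A x ->
          V (twist U i j x) = twist U' i j (V x)].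
Proof.
split=> [TT' A|].
  by have [V []] := equivalent_pieces A hT hT' TT'; exists V.
move=> hV.
have /choice[V VP] : forall A, exists V : H -> K, piece_unitary T U T' U' A V.
  by move=> A; have [V] := hV A; exists V.
pose G z z' := exists A k x, [/\ Dspace T A x, z = list_pow T (enum A) k x
  & z' = list_pow T' (enum A) k (V A x)].
have DV A x : Dspace T A x -> Dspace T' A (V A x).
  by move=> Dx; have [[_ _ <-] _] := VP A; exists x.
have Gin z z' w w' : G z z' -> G w w' -> inner z w = inner z' w'.
  move=> [A [k [x [Dx -> ->]]]] [B [l [y [Dy -> ->]]]].
  (* Different labels give orthogonal vectors on both sides. Equal labels force [A = B] and equal
     exponents on [A]. *)
  have [e|ne] := pselect (slots A k = slots B l); last first.
    rewrite (piece_orth hT ne) ?(piece_orth hT' ne) //.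
    - by rewrite -(list_pow_Dspace hT'); exists (V A x) => //; exact: DV.
    - by rewrite -(list_pow_Dspace hT'); exists (V B y) => //; exact: DV.
    - by rewrite -(list_pow_Dspace hT); exists x.
    - by rewrite -(list_pow_Dspace hT); exists y.
  have sAB i : slots A k i = slots B l i by rewrite e.
  have AB : A = B.
    by apply/setP => i; have := sAB i; rewrite /slots; do 2 case: ifP.
  subst B.
  have kl : {in enum A, l =1 k}.
    by move=> i; rewrite mem_enum => iA; have := sAB i;
      rewrite /slots iA => -[].
  rewrite !(eq_list_pow _ kl).
  (* Within one piece the inner product is that of [x] with the Gram operator applied to [y].
     Condition (i) carries it across, and [Dspace_gram] keeps it where [V A] is isometric. *)
  rewrite (list_pow_adjoint _ _ (T_adj hT)) (list_pow_adjoint _ _ (T_adj hT')).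
  have [[_ Viso _] [hk _ _]] := VP A.
  have := hk (fun i => k (enum_val i)) y Dy; rewrite !tuple_pow_list => <-.
  by rewrite Viso //; exact: (Dspace_gram hT).
have [x hx|x hx|V0 uV0 V0P] := gram_unitary Gin.
- apply: (pieces_total hT) => A k y;
    rewrite -(list_pow_Dspace hT) => -[w Dw <-].
  by apply: (hx _ (list_pow T' (enum A) k (V A w))); exists A, k, w.
- apply: (pieces_total hT') => A k y;
    rewrite -(list_pow_Dspace hT') => -[w' Dw' <-].
  (* Surjectivity of [V A] makes every vector of a piece in [K] the second component of a pair in
     [G]. *)
  have [w Dw wE] : (V A @` Dspace T A) w' by have [[_ _ ->] _] := VP A.
  by apply: (hx (list_pow T (enum A) k w)); exists A, k, w; rewrite wE.
exists V0 => // i x; have [_ _ KV] := unitary_adjP uV0.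
rewrite /= (V0P _ (T' i)) ?KV //; [exact: (T_bound hT)|exact: (T_bound hT')|].
move=> _ _ [A [k [y [Dy -> ->]]]]; have [_ [_ hTj hu]] := VP A.
have [Dw Vw] := list_twist_intertwine i (enum A) k hT hu Dy.
(* In both cases the result is again a generator over [A]: either the exponent at [i] rises, or
   [T i] acts inside D_A(T) and (ii) applies. *)
have [iA|iA] := boolP (i \in A).
  rewrite (T_list_pow_in hT) ?(T_list_pow_in hT') ?enum_uniq ?mem_enum // -Vw.
  by do 3 eexists; split; first exact: Dw.
rewrite (T_list_pow_notin hT) ?(T_list_pow_notin hT') ?mem_enum // -Vw -hTj //.
by do 3 eexists; split; first exact: (Dspace_T hT iA Dw).
Qed.
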